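(* Say that $\mu$ fixes setwise an $\mathbb{F}_q$-plane $\mathcal B\in\mathrm{orb}(\mathsf S_T)$ if all points and lines of $\mathcal B$ have Type III, $\{P^\phi P^{\phi^2}: P\text{ a point of }\mathcal B\}$ equals the set of lines of $\mathcal B$, and $\{\ell^\phi\cap\ell^{\phi^2}:\ell\text{ a line of }\mathcal B\}$ equals the set of points of $\mathcal B$. Then: (1) if $\gcd(3,q-1)=1$, $\mu$ fixes setwise no $\mathbb{F}_q$-plane of $\mathrm{orb}(\mathsf S_T)$; (2) if $\gcd(3,q-1)=3$, $\mu$ fixes setwise exactly two $\mathbb{F}_q$-planes of $\mathrm{orb}(\mathsf S_T)$, namely $\pi_\lambda=\{(x,x^q,\lambda x^{q^2}):x\in\mathbb{F}_{q^3}^*\}$ for $\lambda\in\mathbb{F}_q$ with $\lambda^3=1$, $\lambda\neq1$.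
   Context: Let $q$ be a prime power, $\mathbb{F}_{q^3}^*=\mathbb{F}_{q^3}\setminus\{0\}$. Points of $\mathrm{PG}(2,q^3)$ have homogeneous coordinates $(x,y,z)$ and lines $[a,b,c]$. An $\mathbb{F}_q$-plane is a subplane of order $q$; its lines are those meeting it in $q+1$ points. Let $\phi$ be the collineation $(x,y,z)\mapsto(z^q,x^q,y^q)$ (on lines $[d,e,f]\mapsto[f^q,d^q,e^q]$), with fixed points $\mathcal P_{2,q}=\{(x,x^q,x^{q^2}):x\in\mathbb{F}_{q^3}^*\}$. A point has Type III if its $\phi$-orbit is three non-collinear points; a line has Type III if its $\phi$-orbit is three non-concurrent lines. The map $\mu$ sends a Type III point $P$ to the line $P^\phi P^{\phi^2}$ and a Type III line $\ell$ to the point $\ell^\phi\cap\ell^{\phi^2}$. Let $\psi_t:(x,y,z)\mapsto(tx,t^qy,t^{q^2}z)$ for $t\in\mathbb{F}_{q^3}^*$, $\mathsf S_T=\{\psi_t\}$, and $\mathrm{orb}(\mathsf S_T)$ the set of point orbits of $\mathsf S_T$. *)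

(* Defs.v *)
From mathcomp Require Import all_boot all_order all_algebra all_field.
Set Implicit Arguments. Unset Strict Implicit. Unset Printing Implicit Defensive.
Import GRing.Theory.
Local Open Scope ring_scope.

Section PG2.
Variable F : finFieldType.
Variable q : nat.

(* Homogeneous coordinates (x,y,z) of points, or [a,b,c] of lines. *)
Definition vec := (F * F * F)%type.
Definition c0 (v : vec) : F := v.1.1.
Definition c1 (v : vec) : F := v.1.2.
Definition c2 (v : vec) : F := v.2.
Definition mkv (a b c : F) : vec := (a, b, c).
Definition scalev (s : F) (v : vec) : vec := mkv (s * c0 v) (s * c1 v) (s * c2 v).

Definition normalize (v : vec) : vec :=
  if c0 v != 0 then scalev (c0 v)^-1 v
  else if c1 v != 0 then scalev (c1 v)^-1 v
  else if c2 v != 0 then scalev (c2 v)^-1 v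
  else v.

(* v is the canonical representative of a point (or line) of PG(2,F) *)
Definition is_pv (v : vec) : bool := (v != mkv 0 0 0) && (normalize v == v).

Definition dot (u v : vec) : F := c0 u * c0 v + c1 u * c1 v + c2 u * c2 v.
Definition incident (P l : vec) : bool := dot l P == 0.

Definition cross (u v : vec) : vec :=
  mkv (c1 u * c2 v - c2 u * c1 v) (c2 u * c0 v - c0 u * c2 v)
      (c0 u * c1 v - c1 u * c0 v).
Definition det3 (u v w : vec) : F := dot u (cross v w).

(* phi : (x,y,z) |-> (z^q, x^q, y^q); same formula on lines [d,e,f] |-> [f^q,d^q,e^q] *)
Definition phi (v : vec) : vec := normalize (mkv (c2 v ^+ q) (c0 v ^+ q) (c1 v ^+ q)).

(* Type III: the phi-orbit consists of three non-collinear points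
   (resp. three non-concurrent lines); both amount to det <> 0. *)
Definition typeIII (v : vec) : bool := det3 v (phi v) (phi (phi v)) != 0.

(* mu: point P |-> line P^phi P^phi^2 ; line l |-> point l^phi cap l^phi^2 *)
Definition mu (v : vec) : vec := normalize (cross (phi v) (phi (phi v))).

Definition lines_of (B : {set vec}) : {set vec} :=
  [set l | is_pv l & #|[set P in B | incident P l]| == q.+1].

(* B is a subplane of order q of PG(2,F): the points of B with the lines meeting
   B in at least two points form a projective plane of order q. *)
Definition is_Fq_plane (B : {set vec}) : bool :=
  [&& [forall P in B, is_pv P],
      [forall l, is_pv l ==>
         (#|[set P in B | incident P l]| <= 1)%N
         || (#|[set P in B | incident P l]| == q.+1)],
      [forall l in lines_of B, forall m in lines_of B,
         (l != m) ==> [exists P in B, incident P l && incident P m]] &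
      [exists a in B, exists b in B, exists c in B, exists d in B,
         [&& det3 a b c != 0, det3 a b d != 0, det3 a c d != 0 & det3 b c d != 0]]].

Definition nonzeroF : {set F} := [set t : F | t != 0].

Definition orbit_ST (v : vec) : {set vec} :=
  [set normalize (mkv (t * c0 v) (t ^+ q * c1 v) (t ^+ (q * q)%N * c2 v)) | t in nonzeroF].

Definition is_ST_orbit (B : {set vec}) : bool :=
  [exists v, is_pv v && (B == orbit_ST v)].

Definition mu_fixes (B : {set vec}) : bool :=
  [&& [forall P in B, typeIII P],
      [forall l in lines_of B, typeIII l],
      [set mu P | P in B] == lines_of B &
      [set mu l | l in lines_of B] == B].

Definition good_plane (B : {set vec}) : bool :=
  [&& is_ST_orbit B, is_Fq_plane B & mu_fixes B].

Definition pi_lam (lam : F) : {set vec} :=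
  [set normalize (mkv x (x ^+ q) (lam * x ^+ (q * q)%N)) | x in nonzeroF].

End PG2.

(* Main.v *)
(** An orbit that is an [F_q]-plane consists of points [(a, b, c)] without zero
    coordinates. Write [x'] for [x ^+ q]; [y] ranges over the nonzero scalars. The lines of its orbit plane are the [[y / a, y' / b, y'' / c]],
    and [mu] sends [(a, b, c)] to a multiple of [[u / a, v / b, w / c]] with
    [u = N a - al], [v = N b - al''], [w = N c - al'], where [N] is the norm and
    [al = a b' c'']. So [mu] can fix the plane only if [(u, v, w)] is proportional
    to some [(y, y', y'')]. The resulting quadratic relations between the conjugates
    of [al] and the norms, together with [N al = N a * N b * N c], force [al] into
    the subfield of order [q] and [N a = N b = N c]; then [lam = al / N a] is a
    nontrivial cube root of unity, and Hilbert 90 turns the orbit into [pi_lam].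
    Conversely the lines of [pi_lam] form [pi_{1 / lam}], and [mu] sends the point
    of parameter [x] of [pi_lam] to that of parameter [1 / x] of [pi_{1 / lam}]. *)

Require Import Defs.
From mathcomp Require Import all_boot all_order all_algebra all_field.
From mathcomp Require Import ring zify.
Set Implicit Arguments. Unset Strict Implicit. Unset Printing Implicit Defensive.
Import GRing.Theory.
Local Open Scope ring_scope.

(** * Homogeneous vectors, normalization and the cross product *)

Section Projective.
Variable F : finFieldType.
Implicit Types (u v w : vec F) (a b c r : F).

Lemma vec_ext u v : c0 u = c0 v -> c1 u = c1 v -> c2 u = c2 v -> u = v.
Proof. by case: u v => [[? ?] ?] [[? ?] ?]; rewrite /c0 /c1 /c2 /= => -> -> ->. Qed.

Lemma vec_eq0 v : (v == mkv 0 0 0) = [&& c0 v == 0, c1 v == 0 & c2 v == 0].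
Proof. by case: v => [[a b] c]; rewrite /mkv !xpair_eqE andbA. Qed.

Lemma scale1v v : scalev 1 v = v.
Proof. by apply: vec_ext; rewrite /dot /scalev /cross /c0 /c1 /c2 /= mul1r. Qed.

Lemma scalevA a b v : scalev a (scalev b v) = scalev (a * b) v.
Proof. by apply: vec_ext; rewrite /dot /scalev /cross /c0 /c1 /c2 /= mulrA. Qed.

Lemma scalev_neq0 r v : r != 0 -> (scalev r v == mkv 0 0 0) = (v == mkv 0 0 0).
Proof. by move=> r0; rewrite !vec_eq0 /scalev /cross /c0 /c1 /c2 /= !mulf_eq0 (negPf r0). Qed.

Lemma dot_scalel r u v : dot (scalev r u) v = r * dot u v.
Proof. by rewrite /dot /scalev /cross /c0 /c1 /c2 /=; ring. Qed.

Lemma dot_scaler r u v : dot u (scalev r v) = r * dot u v.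
Proof. by rewrite /dot /scalev /cross /c0 /c1 /c2 /=; ring. Qed.

Lemma cross_scale a b u v :
  cross (scalev a u) (scalev b v) = scalev (a * b) (cross u v).
Proof. by apply: vec_ext; rewrite /dot /scalev /cross /c0 /c1 /c2 /=; ring. Qed.

Lemma det3_scale a b c u v w :
  det3 (scalev a u) (scalev b v) (scalev c w) = a * b * c * det3 u v w.
Proof. by rewrite /det3 cross_scale dot_scalel dot_scaler; ring. Qed.

Lemma normalize_scaleP v : exists2 r, r != 0 & normalize v = scalev r v.
Proof.
rewrite /normalize; case: ifPn => [h|_]; first by exists (c0 v)^-1; rewrite ?invr_eq0.
case: ifPn => [h|_]; first by exists (c1 v)^-1; rewrite ?invr_eq0.
case: ifPn => [h|_]; first by exists (c2 v)^-1; rewrite ?invr_eq0.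
by exists 1; rewrite ?oner_neq0 ?scale1v.
Qed.

Lemma normalize_scale r v : r != 0 -> normalize (scalev r v) = normalize v.
Proof.
move=> r0; have key a : a != 0 -> scalev (r * a)^-1 (scalev r v) = scalev a^-1 v.
  by move=> a0; rewrite scalevA invfM mulrAC mulVf ?mul1r.
rewrite /normalize /scalev /cross /c0 /c1 /c2 /= !mulf_eq0 (negPf r0) /=.
case: ifPn => [/key //|/negPn/eqP e0]; case: ifPn => [/key //|/negPn/eqP e1].
case: ifPn => [/key //|/negPn/eqP e2].
by apply: vec_ext; rewrite /dot /scalev /cross /c0 /c1 /c2 /= ?e0 ?e1 ?e2 mulr0.
Qed.

Lemma normalize_id v : normalize (normalize v) = normalize v.
Proof. by have [r r0 {1}->] := normalize_scaleP v; rewrite normalize_scale. Qed.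

Lemma normalize_eqP u v :
  reflect (exists2 r, r != 0 & u = scalev r v) (normalize u == normalize v).
Proof.
apply: (iffP eqP) => [|[r r0 ->]]; last exact: normalize_scale.
have [a a0 ->] := normalize_scaleP u; have [b b0 ->] := normalize_scaleP v.
move=> e; exists (a^-1 * b); first by rewrite mulf_neq0 ?invr_eq0.
by rewrite -scalevA -e scalevA mulVf ?scale1v.
Qed.

Lemma normalize_eq0 v : (normalize v == mkv 0 0 0) = (v == mkv 0 0 0).
Proof. by have [r r0 ->] := normalize_scaleP v; rewrite scalev_neq0. Qed.

Lemma is_pv_normalize v : is_pv (normalize v) = (v != mkv 0 0 0).
Proof. by rewrite /is_pv normalize_eq0 normalize_id eqxx andbT. Qed.

Lemma is_pvP v : is_pv v -> normalize v = v.
Proof. by case/andP=> _ /eqP. Qed.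

Lemma incident_normalizel v l : incident (normalize v) l = incident v l.
Proof.
have [r r0 ->] := normalize_scaleP v.
by rewrite /incident dot_scaler mulf_eq0 (negPf r0).
Qed.

Lemma incident_normalizer v l : incident v (normalize l) = incident v l.
Proof.
have [r r0 ->] := normalize_scaleP l.
by rewrite /incident dot_scalel mulf_eq0 (negPf r0).
Qed.

Lemma det3_normalize u v w :
  (det3 (normalize u) (normalize v) (normalize w) == 0) = (det3 u v w == 0).
Proof.
have [a a0 ->] := normalize_scaleP u; have [b b0 ->] := normalize_scaleP v.
have [c c0 ->] := normalize_scaleP w; rewrite det3_scale !mulf_eq0.
by rewrite (negPf a0) (negPf b0) (negPf c0).
Qed.

Lemma normalize_cross u v :
  normalize (cross (normalize u) (normalize v)) = normalize (cross u v).
Proof.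
have [a a0 ->] := normalize_scaleP u; have [b b0 ->] := normalize_scaleP v.
by rewrite cross_scale normalize_scale // mulf_neq0.
Qed.

Lemma cross_eq0 u v : v != mkv 0 0 0 -> cross u v = mkv 0 0 0 ->
  exists r, u = scalev r v.
Proof.
case: u v => [[a b] c] [[x y] z]; rewrite vec_eq0 /scalev /cross /c0 /c1 /c2 /= => v0 [].
move=> /subr0_eq e1 /subr0_eq e2 /subr0_eq e3.
have [x0|x0] := eqVneq x 0; last first.
  exists (a / x); apply: vec_ext; rewrite /dot /scalev /cross /c0 /c1 /c2 /= ?divfK // mulrAC.
    by rewrite e3 mulfK.
  by rewrite -e2 mulfK.
have [y0|y0] := eqVneq y 0; last first.
  exists (b / y); apply: vec_ext; rewrite /dot /scalev /cross /c0 /c1 /c2 /= ?divfK // mulrAC.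
    by rewrite -e3 mulfK.
  by rewrite e1 mulfK.
have z0 : z != 0 by move: v0; rewrite x0 y0 eqxx.
exists (c / z); apply: vec_ext; rewrite /dot /scalev /cross /c0 /c1 /c2 /= ?divfK // mulrAC.
  by rewrite e2 mulfK.
by rewrite -e1 mulfK.
Qed.

(** The triple product expansion writes [cross l (cross u v)] as a combination of [u] and [v] with
    coefficients [dot l v] and [- dot l u], which both vanish. *)
Lemma line_through2 u v l : cross u v != mkv 0 0 0 ->
  dot l u = 0 -> dot l v = 0 -> exists r, l = scalev r (cross u v).
Proof.
move=> uv0 lu lv; apply: cross_eq0 => //.
have -> : cross l (cross u v) = mkv (dot l v * c0 u - dot l u * c0 v)
   (dot l v * c1 u - dot l u * c1 v) (dot l v * c2 u - dot l u * c2 v).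
  by apply: vec_ext; rewrite /dot /scalev /cross /c0 /c1 /c2 /=; ring.
by rewrite lu lv !mul0r subrr.
Qed.

End Projective.

(** * Counting by fibers, polynomial roots and Frobenius powers *)

Section Fibers.
Variables (T T' : finType) (f : T -> T') (A : {set T}) (n : nat).

Lemma card_fibers : #|A| = (\sum_(y in f @: A) #|[set x in A | f x == y]|)%N.
Proof.
rewrite -sum1_card (partition_big_imset f); apply: eq_bigr => y _.
by rewrite -sum1_card; apply: eq_bigl => x; rewrite inE.
Qed.

Lemma leq_card_fibers :
  (forall y, #|[set x in A | f x == y]| <= n)%N -> (#|A| <= #|f @: A| * n)%N.
Proof. by move=> h; rewrite card_fibers -sum_nat_const leq_sum. Qed.

Lemma card_const_fibers :
  (forall x, x \in A -> #|[set y in A | f y == f x]| = n) ->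
  #|A| = (#|f @: A| * n)%N.
Proof.
move=> h; rewrite card_fibers -sum_nat_const; apply: eq_bigr => y.
by case/imsetP=> x /h e ->.
Qed.
End Fibers.

Lemma card_roots (F : finFieldType) (p : {poly F}) :
  p != 0 -> (#|[set x | root p x]| < size p)%N.
Proof.
move=> p0; rewrite cardE; apply: max_poly_roots => //; last exact: enum_uniq.
by apply/allP => x; rewrite mem_enum inE.
Qed.

(** Packaging the power map as a ring morphism makes conjugation commute with sums, products and
    inverses by the generic morphism lemmas. *)
Lemma rmorph_expp (F : finFieldType) (p k : nat) : p \in [pchar F] ->
  exists s : {rmorphism F -> F}, forall x, s x = x ^+ (p ^ k).
Proof.
move=> pF; elim: k => [|k [s sE]].
  by exists (idfun : {rmorphism F -> F}) => x; rewrite expn0 expr1.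
exists (pFrobenius_aut pF \o s : {rmorphism F -> F}) => x /=.
by rewrite sE pFrobenius_autE -exprM -expnSr.
Qed.

(** The quadratic relations give [(p - q) * (p + q + r) = 0]. If the sum vanishes, so does the
    second symmetric function, which equals [p * (p + q + r)]; the cubic relation then leaves
    [p * q * r = 0], that is [p ^+ 3 = 0]. *)
Lemma equal_of_shifted_products (F : fieldType) (al p q r : F) :
  al ^+ 3 = (p + al) * (q + al) * (r + al) -> p != 0 ->
  p * r = q ^+ 2 -> p * q = r ^+ 2 -> q * r = p ^+ 2 -> p = q /\ p = r.
Proof.
move=> n p0 pr pq qr.
have sq : (p - q) * (p + q + r) = 0.
  by transitivity (p ^+ 2 - q ^+ 2 + p * r - q * r); [ring | rewrite pr qr; ring].
have [s0|s0] := eqVneq (p + q + r) 0; last first.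
  move/eqP: sq; rewrite mulf_eq0 (negPf s0) orbF subr_eq0 => /eqP e.
  by split=> //; apply: (mulfI p0); rewrite pr -e expr2.
have e2 : p * q + q * r + p * r = 0.
  rewrite pq qr pr.
  have := congr1 (fun x => x * p) s0; rewrite /= mul0r => {}s0.
  by rewrite -{}s0 !mulrDl [q * p]mulrC [r * p]mulrC pq pr; ring.
have : p * q * r = 0.
  transitivity ((p + al) * (q + al) * (r + al) - al ^+ 3
     - al ^+ 2 * (p + q + r) - al * (p * q + q * r + p * r)); first by ring.
  by rewrite -n s0 e2; ring.
by rewrite -mulrA qr => /eqP; rewrite mulf_eq0 expf_eq0 /= (negPf p0).
Qed.

(** * The [q]-power map on a field of order [q ^ 3]: counting, trace and Hilbert 90 *)

Section Frobenius.
Variables (F : finFieldType) (q : nat) (s : {rmorphism F -> F}).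
Hypotheses (q_gt1 : (1 < q)%N) (sE : forall x, s x = x ^+ q).
Hypothesis cardF : #|F| = (q ^ 3)%N.
Implicit Types (x y z d e f lam : F) (u v w l m : vec F).

Lemma s_cubed x : s (s (s x)) = x.
Proof. by rewrite !sE -[RHS]expf_card cardF !expnS expn0 muln1 !exprM. Qed.

Lemma s_eq0 x : (s x == 0) = (x == 0).
Proof. exact: fmorph_eq0. Qed.

Lemma card_qpoly2 d e f y : [|| d != 0, e != 0 | f != 0] ->
  (#|[set x | (d * x + e * s x + f * s (s x))%R == y]| <= q ^ 2)%N.
Proof.
move=> def0; pose p := d *: 'X + e *: 'X^q + f *: 'X^(q * q) - y%:P.
(* Positive indices avoid the constant term [y]. As [q > 1], the exponents 1, [q] and [q * q] are
   distinct, so [d], [e] and [f] can be read off separately. *)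
have coefp i : (0 < i)%N ->
    p`_i = d * (i == 1)%:R + e * (i == q)%:R + f * (i == q * q)%N%:R.
  by move=> i0; rewrite !(coefE, coefC) -[i == 0%N]negbK -lt0n i0 subr0.
have qq : (q < q * q)%N by rewrite ltn_Pmulr // ltnW.
have p0 : p != 0.
  apply: contraL def0 => /eqP p0; rewrite !negb_or !negbK.
  move: (coefp 1%N isT) (coefp q (ltnW q_gt1)) (coefp (q * q)%N (leq_trans (ltnW q_gt1) (ltnW qq))).
  rewrite p0 !coef0 !eqxx (gtn_eqF q_gt1) (ltn_eqF q_gt1) (ltn_eqF qq) (gtn_eqF qq).
  rewrite (gtn_eqF (ltn_trans q_gt1 qq)) (ltn_eqF (ltn_trans q_gt1 qq)).
  by rewrite !(mulr0, mulr1, addr0, add0r) => <- <- <-; rewrite eqxx.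
have sp : (size p <= (q ^ 2).+1)%N.
  apply/leq_sizeP => j hj; rewrite coefp; last by lia.
  rewrite -mulnn in hj.
  by rewrite !gtn_eqF ?mulr0 ?addr0 //; apply: leq_trans hj; lia.
rewrite -ltnS; apply: leq_trans sp; apply: leq_trans (card_roots p0).
rewrite ltnS subset_leq_card //; apply/subsetP => x; rewrite !inE => /eqP h.
by rewrite rootE !hornerE exprM -!sE h subrr.
Qed.

Lemma card_qpoly1 y : (#|[set x | (s x - x)%R == y]| <= q)%N.
Proof.
pose p := 'X^q - ('X + y%:P) : {poly F}.
have sp : size p = q.+1.
  by rewrite size_polyDl ?size_polyXn ?size_polyN ?size_XaddC // ltnS.
have p0 : p != 0 by rewrite -size_poly_eq0 sp.
rewrite -ltnS -sp; apply: leq_trans (card_roots p0).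
rewrite ltnS subset_leq_card //; apply/subsetP => x; rewrite !inE => /eqP h.
by rewrite rootE !hornerE -!sE opprD addrA h subrr.
Qed.

Definition tr x := x + s x + s (s x).

Lemma s_tr x : s (tr x) = tr x.
Proof. by rewrite /tr !rmorphD s_cubed; ring. Qed.

Lemma card_tr y : (#|[set x | tr x == y]| <= q ^ 2)%N.
Proof.
have := @card_qpoly2 1 1 1 y; rewrite oner_neq0 => /(_ isT).
by apply: leq_trans; rewrite subset_leq_card //; apply/subsetP => x; rewrite !inE !mul1r.
Qed.

(* The root bounds are attained since [x |-> s x - x] maps into the kernel of [tr]
   with fibers of size at most [q], and [q ^ 3 = q * q ^ 2]. *)
Lemma card_tr0 : #|[set x | tr x == 0]| = (q ^ 2)%N.
Proof.
apply/eqP; rewrite eqn_leq card_tr /=.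
have q0 : (0 < q)%N by exact: ltnW.
have h : (#|[set: F]| <= #|(fun x => (s x - x)%R) @: [set: F]| * q)%N.
  apply: leq_card_fibers => y; apply: leq_trans (card_qpoly1 y).
  by rewrite subset_leq_card //; apply/subsetP => x; rewrite !inE.
rewrite cardsT cardF expnSr leq_pmul2r // in h; apply: leq_trans h _.
rewrite subset_leq_card //; apply/subsetP => _ /imsetP[x _ ->].
by rewrite inE /tr !rmorphB s_cubed; apply/eqP; ring.
Qed.

(** Here the lower bound comes from [tr], which maps into the fixed set with fibers of size at most
    [q ^ 2]. *)
Lemma card_fixed : #|[set x | s x == x]| = q.
Proof.
have q0 : (0 < q)%N by exact: ltnW.
apply/eqP; rewrite eqn_leq; apply/andP; split.
  apply: leq_trans (card_qpoly1 0); rewrite subset_leq_card //.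
  by apply/subsetP => x; rewrite !inE subr_eq0.
have h : (#|[set: F]| <= #|tr @: [set: F]| * q ^ 2)%N.
  apply: leq_card_fibers => y; apply: leq_trans (card_tr y).
  by rewrite subset_leq_card //; apply/subsetP => x; rewrite !inE.
rewrite cardsT cardF expnS leq_pmul2r ?expn_gt0 ?q0 // in h.
apply: leq_trans h _; rewrite subset_leq_card //.
by apply/subsetP => _ /imsetP[x _ ->]; rewrite inE s_tr.
Qed.

(** Independence of the three conjugations, by counting: at most [q ^ 2] of the [q ^ 3] elements are
    zeros. *)
Lemma exists_qpoly2_neq0 d e f : [|| d != 0, e != 0 | f != 0] ->
  exists x, d * x + e * s x + f * s (s x) != 0.
Proof.
move=> h; apply/existsP; apply: contraLR (card_qpoly2 0 h) => /existsPn h0.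
rewrite -ltnNge (_ : [set _ | _] = setT) ?cardsT ?cardF ?ltn_exp2l //.
by apply/setP => x; rewrite !inE; have /negPn := h0 x.
Qed.

Lemma exists_not_fixed : exists x, s x != x.
Proof.
apply/existsP; move/eqP: card_fixed; apply: contraLR => /existsPn h0; rewrite neq_ltn.
apply/orP; right; rewrite (_ : [set _ | _] = setT) ?cardsT ?cardF.
  by rewrite -{1}[q]expn1 ltn_exp2l.
by apply/setP => x; rewrite !inE; have /negPn := h0 x.
Qed.

(** The witness is a Lagrange resolvent: [s] permutes its three terms cyclically up to the factor
    [c], because [c] has norm 1. Independence of the conjugations makes it nonzero for some [x]. *)
Lemma hilbert90 (c : F) : c * s c * s (s c) = 1 ->
  exists2 h, h != 0 & s h = c * h.
Proof.
move=> nc; have c0 : c != 0.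
  by apply: contra_eq_neq nc => ->; rewrite !mul0r eq_sym oner_neq0.
have [|x hx] := @exists_qpoly2_neq0 1 c^-1 (c * s c)^-1; first by rewrite oner_neq0.
exists (1 * x + c^-1 * s x + (c * s c)^-1 * s (s x)) => //.
have sc0 : s c != 0 by rewrite s_eq0.
have -> : (c * s c)^-1 = s (s c).
  by apply: (mulfI (mulf_neq0 c0 sc0)); rewrite divff ?mulf_neq0.
have -> : c^-1 = s c * s (s c) by apply: (mulfI c0); rewrite divff // mulrA nc.
rewrite !rmorphD !rmorphM !s_cubed rmorph1.
have -> : s c * s (s c) = c^-1 by apply: (mulfI c0); rewrite divff // mulrA nc.
rewrite !mulrDr !mulrA divff // [c * s (s c)]mulrC.
have -> : s (s c) * c = (s c)^-1.
  by apply: (mulfI sc0); rewrite divff // -nc; ring.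
by ring.
Qed.

(* Proportionality to [(y, s y, s (s y))] is the vanishing of three quadratic
   expressions; the first says that [(e1 - (A + B + C)) * al] is fixed by [s],
   where [e1] is the trace of [al]. Hence [al] is fixed by [s], or else
   [A], [B], [C] are the roots of its characteristic polynomial. *)
Lemma norm_shift_proportional (A B C al r y : F) :
  s A = A -> s B = B -> s C = C -> al * s al * s (s al) = A * B * C ->
  r != 0 -> y != 0 ->
  A - al = r * y -> B - s (s al) = r * s y -> C - s al = r * s (s y) ->
  [/\ s al = al, A = B, A = C & A != al].
Proof.
move=> sA sB sC nal r0 y0 u v w.
(* Conjugating the hypotheses gives all nine differences between a norm and a conjugate of [al] as
   products of a conjugate of [r] and one of [y]. Pairing them so that the same factors appear on
   both sides eliminates [r] and [y]. *)
have u1 : A - s al = s r * s y by rewrite -rmorphM -u rmorphB sA.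
have u2 : A - s (s al) = s (s r) * s (s y) by rewrite -!rmorphM -u !rmorphB !sA.
have v1 : B - al = s r * s (s y) by rewrite -rmorphM -v rmorphB sB s_cubed.
have v2 : B - s al = s (s r) * y by rewrite -[y]s_cubed -!rmorphM -v !rmorphB !sB s_cubed.
have w1 : C - s (s al) = s r * y by rewrite -[y]s_cubed -!rmorphM -w rmorphB !sC.
have w2 : C - al = s (s r) * s y by rewrite -[y]s_cubed -!rmorphM -w !rmorphB !sC !s_cubed.
have F1 : (A - al) * (C - al) = (B - s al) * (B - s (s al)).
  by rewrite u w2 v v2; ring.
have F2 : (A - al) * (B - al) = (C - s al) * (C - s (s al)).
  by rewrite u v1 w w1; ring.
have F3 : (B - al) * (C - al) = (A - s al) * (A - s (s al)).
  by rewrite v1 w2 u1 u2; ring.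
have al_neq : A != al by rewrite -subr_eq0 u mulf_neq0.
have sal : s al = al.
  have [e1 e1E] : exists e1, e1 = al + s al + s (s al) by eexists.
  have [e2 e2E] : exists e2, e2 = al * s al + al * s (s al) + s al * s (s al).
    by eexists.
  have D : (e1 - (A + B + C)) * al = e2 - B * e1 + B ^+ 2 - A * C.
    apply: subr0_eq; rewrite -(subrr ((A - al) * (C - al))) {2}F1 e1E e2E.
    by ring.
  have s1 : s e1 = e1 by rewrite e1E !rmorphD s_cubed; ring.
  have s2 : s e2 = e2 by rewrite e2E !rmorphD !rmorphM s_cubed; ring.
  have D1 : (e1 - (A + B + C)) * s al = e2 - B * e1 + B ^+ 2 - A * C.
    move/(congr1 s): D.
    by rewrite rmorphM !(rmorphB, rmorphD) rmorphXn !rmorphM s1 s2 sA sB sC.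
  have [e1S|e1S] := eqVneq (e1 - (A + B + C)) 0; last by apply: (mulfI e1S); rewrite D.
  (* Now [e1 = A + B + C], and [D] becomes [e2 = A * B + B * C + A * C]. Hence [al] is one of [A],
     [B], [C], all fixed by [s]. *)
  move: D; rewrite e1S mul0r => /esym D.
  have /eqP : (al - A) * (al - B) * (al - C) = 0.
    transitivity (al * s al * s (s al) - A * B * C
       + al ^+ 2 * (e1 - (A + B + C)) - al * (e2 - B * e1 + B ^+ 2 - A * C)
       - al * B * (e1 - (A + B + C))); first by rewrite e1E e2E; ring.
    by rewrite nal D e1S; ring.
  by rewrite !mulf_eq0 !subr_eq0 => /orP[/orP[]|] /eqP ->.
move: nal F1 F2 F3; rewrite !sal => nal F1 F2 F3.
have [|||||eB eC] := @equal_of_shifted_products F al (A - al) (B - al) (C - al).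
- by rewrite !subrK -nal; ring.
- by rewrite subr_eq0.
- by rewrite F1 expr2.
- by rewrite F2 expr2.
- by rewrite F3 expr2.
by split=> //; [apply: (addIr (- al)) | apply: (addIr (- al))].
Qed.

(** * Parametrized points, their joins, and the maps [phi] and [mu] *)

Definition pt lam x : vec F := mkv x (s x) (lam * s (s x)).

Lemma pt_neq0 lam x : x != 0 -> pt lam x != mkv 0 0 0.
Proof. by move=> x0; rewrite vec_eq0 negb_and x0. Qed.

Lemma pt_fixed_scale lam k x : s k = k -> pt lam (k * x) = scalev k (pt lam x).
Proof.
by move=> sk; apply: vec_ext; rewrite /c0 /c1 /c2 /= ?rmorphM ?rmorphM ?sk // mulrCA.
Qed.

Lemma pi_lamE lam : pi_lam q lam = [set normalize (pt lam x) | x in nonzeroF F].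
Proof. by apply: eq_imset => x; rewrite /pt !sE -exprM. Qed.

(** For nonzero [x] and [y], this vanishes exactly when [x / y] is fixed by [s], that is when [x]
    and [y] parametrize the same point. Its conjugates give the coordinates of the join. *)
Definition wedge x y := x * s y - s x * y.

Lemma cross_pt lam x y : cross (pt lam x) (pt lam y) =
  mkv (lam * s (wedge x y)) (lam * s (s (wedge x y))) (wedge x y).
Proof.
apply: vec_ext; rewrite /wedge /cross /c0 /c1 /c2 /= ?rmorphB ?rmorphM ?rmorphB ?rmorphM ?s_cubed; ring.
Qed.

Lemma wedge_eq0 x y : y != 0 -> wedge x y = 0 -> exists2 k, s k = k & x = k * y.
Proof.
move=> y0 /subr0_eq e; have sy0 : s y != 0 by rewrite fmorph_eq0.
exists (x / y); last by rewrite divfK.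
by rewrite fmorph_div; apply: (canLR (mulfK sy0)); rewrite mulrAC e mulfK.
Qed.

(** For [lam = 1] the join of two points is itself of the form [pt 1 z], with
    [z = s (wedge x y)]. *)
Lemma proportional_pt1 m x y : wedge x y != 0 ->
  dot m (pt 1 x) = 0 -> dot m (pt 1 y) = 0 ->
  exists r z, z != 0 /\ m = scalev r (pt 1 z).
Proof.
move=> xy0 mx my; have [|r ->] := line_through2 _ mx my.
  by rewrite cross_pt vec_eq0 /c0 /c1 /c2 /= (negPf xy0) !andbF.
exists r, (s (wedge x y)); split; first by rewrite fmorph_eq0.
by rewrite cross_pt /pt s_cubed !mul1r.
Qed.

(* [phi] before normalization. *)
Definition twist v : vec F := mkv (s (c2 v)) (s (c0 v)) (s (c1 v)).

Lemma twist_scale r v : twist (scalev r v) = scalev (s r) (twist v).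
Proof. by apply: vec_ext; rewrite /c0 /c1 /c2 /= ?rmorphM. Qed.

Lemma phiE v : phi q v = normalize (twist v).
Proof. by rewrite /phi -!sE. Qed.

Lemma phi_normalize v : phi q (normalize v) = normalize (twist v).
Proof.
have [r r0 ->] := normalize_scaleP v.
by rewrite phiE twist_scale normalize_scale // fmorph_eq0.
Qed.

Lemma muE v : mu q v = normalize (cross (twist v) (twist (twist v))).
Proof. by rewrite /mu phiE phi_normalize normalize_cross. Qed.

Lemma mu_normalize v : mu q (normalize v) = mu q v.
Proof. by rewrite /mu phi_normalize -phiE. Qed.

Lemma typeIII_normalize v :
  typeIII q (normalize v) = (det3 v (twist v) (twist (twist v)) != 0).
Proof. by rewrite /typeIII !phi_normalize det3_normalize. Qed.

(** * Orbits of the maps [psi_x] and the lines that [mu] assigns to them *)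

Definition tpt v x : vec F := mkv (x * c0 v) (s x * c1 v) (s (s x) * c2 v).

Lemma orbit_STE v : orbit_ST q v = [set normalize (tpt v x) | x in nonzeroF F].
Proof. by apply: eq_imset => x; rewrite /tpt !sE -exprM. Qed.

Lemma tpt_scale v x : tpt v x = 
  mkv (c0 v * c0 (pt 1 x)) (c1 v * c1 (pt 1 x)) (c2 v * c2 (pt 1 x)).
Proof. by apply: vec_ext; rewrite /c0 /c1 /c2 /= ?mul1r mulrC. Qed.

(** The orbit is a diagonal image of the points [pt 1 x], so every determinant of three of its
    points has the factor [c0 v * c1 v * c2 v]; a quadrangle provides a nonzero one. *)
Lemma Fq_plane_coords v : is_Fq_plane q (orbit_ST q v) ->
  [/\ c0 v != 0, c1 v != 0 & c2 v != 0].
Proof.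
case/and4P=> _ _ _ /exists_inP[a aB] /exists_inP[b bB] /exists_inP[c cB].
case/exists_inP=> d _ /and4P[+ _ _ _].
move: aB bB cB; rewrite orbit_STE.
case/imsetP=> x _ ->; case/imsetP=> y _ ->; case/imsetP=> z _ ->.
rewrite det3_normalize => h.
have e : det3 (tpt v x) (tpt v y) (tpt v z) =
  c0 v * c1 v * c2 v * det3 (pt 1 x) (pt 1 y) (pt 1 z).
  by rewrite !tpt_scale /det3 /dot /cross /c0 /c1 /c2 /=; ring.
by move: h; rewrite e !mulf_eq0 !negb_or => /andP[/andP[/andP[]]].
Qed.

Lemma pi_lam_of_mu_line v : is_Fq_plane q (orbit_ST q v) ->
  mu q v \in lines_of q (orbit_ST q v) ->
  exists2 lam, [&& lam ^+ q == lam, lam ^+ 3 == 1 & lam != 1]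
    & orbit_ST q v = pi_lam q lam.
Proof.
case/Fq_plane_coords; case: v => [[a b] c]; rewrite {1}/c0 {1}/c1 {1}/c2 /= => a0 b0 c_0.
set v := (a, b, c).
rewrite inE muE is_pv_normalize.
set n := cross _ _ => /andP[n0 /eqP cq].
have /card_gt1P[P1 [P2 [h1 h2]]] : (1 < #|[set P in orbit_ST q v | incident P (normalize n)]|)%N.
  by rewrite cq ltnS ltnW.
move: h1 h2; rewrite !inE orbit_STE => /andP[/imsetP[x x0 ->]] i1.
case/andP=> /imsetP[y y0 ->]; move: x0 y0 i1; rewrite !inE.
rewrite !incident_normalizer !incident_normalizel /incident.
move=> x0 y0 /eqP i1 /eqP i2 nxy.
(* The line [n] pulled back along the diagonal map with entries [a], [b], [c]; it passes through two
   distinct points [pt 1 x] and [pt 1 y]. *)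
pose m := mkv (c0 n * a) (c1 n * b) (c2 n * c).
have md z : dot m (pt 1 z) = dot n (tpt v z).
  by rewrite /dot /m /pt /tpt /c1 /c2 /c0 /=; ring.
have [|||r [z [z0 mE]]] := @proportional_pt1 m x y; rewrite ?md //.
  apply: contraNneq nxy => /(wedge_eq0 y0)[k sk xE].
  apply/normalize_eqP; exists k; first by apply: contraNneq x0 => k0; rewrite xE k0 mul0r.
  by rewrite xE; apply: vec_ext; rewrite /tpt /pt /c1 /c2 /c0 /= ?rmorphM ?rmorphM ?sk mulrA.
have r0 : r != 0.
  apply: contraNneq n0 => r0; move: mE; rewrite r0 /scalev !mul0r => /eqP.
  by rewrite !vec_eq0 /c1 /c2 /c0 /= !mulf_eq0 (negPf a0) (negPf b0) (negPf c_0) !orbF.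
case: mE; rewrite mul1r.
pose A := a * s a * s (s a); pose B := b * s b * s (s b); pose C := c * s c * s (s c).
pose al := a * s b * s (s c).
rewrite /n /cross /twist /c1 /c2 /c0 /= => mA mB mC.
have [||||||||| sal AB AC Aal] := @norm_shift_proportional A B C al r z; rewrite ?r0 ?z0 //.
- by rewrite /A !rmorphM s_cubed; ring.
- by rewrite /B !rmorphM s_cubed; ring.
- by rewrite /C !rmorphM s_cubed; ring.
- by rewrite /A /B /C /al !rmorphM !s_cubed; ring.
- by rewrite -mA /A /al; ring.
- by rewrite -mB /B /al !rmorphM !s_cubed; ring.
- by rewrite -mC /C /al !rmorphM !s_cubed; ring.
have nz x' : x' != 0 -> s x' != 0 by rewrite fmorph_eq0.
have A0 : A != 0 by rewrite /A !mulf_neq0 ?nz.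
have sA : s A = A by rewrite /A !rmorphM s_cubed; ring.
exists (al / A).
  have ->: (al / A) ^+ q = al / A by rewrite -sE fmorph_div sA sal.
  rewrite eqxx /= expr_div_n; apply/andP; split.
    apply/eqP; apply: (canLR (mulfK (expf_neq0 _ A0))); rewrite mul1r.
    rewrite [RHS](_ : _ = A * B * C); last by rewrite -AB -AC; ring.
    rewrite [LHS](_ : _ = al * s al * s (s al)); last by rewrite !sal; ring.
    by rewrite /A /B /C /al !rmorphM !s_cubed; ring.
  apply: contraNneq Aal => e; rewrite -(divfK A0 al) e mul1r //.
(* The norm of [b / a] is [B / A = 1]. The substitution of [h * x] for [x] makes the first two
   coordinates of the orbit conjugate, up to a common scalar. *)
have [h h0 sh] : exists2 h, h != 0 & s h = b / a * h.
  apply: (hilbert90).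
  rewrite !fmorph_div; transitivity (B / A); last by rewrite -AB divff.
  by rewrite /A /B; field; rewrite !nz.
have tptE x' : tpt v x' = scalev (a / h) (pt (al / A) (h * x')).
  (* Since [al] is fixed, it equals [s a * s (s b) * c]; solving for [c] and using [A = B] gives
     this form. *)
  have cE : c = al / A * (b * s b / s a).
    rewrite -{1}sal /al !rmorphM s_cubed; transitivity (c * (B / A)).
      by rewrite -AB divff ?mulr1.
    by rewrite /B; field; rewrite A0 nz.
  apply: vec_ext; rewrite /tpt /pt /scalev /c1 /c2 /c0 /= ?rmorphM ?rmorphM.
  - by field.
  - by rewrite sh; field; rewrite a0.
  - by rewrite !sh !rmorphM fmorphV sh {1}cE; field; rewrite A0 nz // h0 a0.
rewrite pi_lamE; apply/setP => P.
apply/imsetP/imsetP => -[t]; rewrite !inE => t0 ->.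
  exists (h * t); first by rewrite inE mulf_neq0.
  by rewrite tptE normalize_scale // mulf_neq0 ?invr_eq0.
exists (h^-1 * t); first by rewrite inE mulf_neq0 ?invr_eq0.
by rewrite tptE normalize_scale ?mulf_neq0 ?invr_eq0 // mulVKf.
Qed.

(** * The subplane [pi_lam]: incidence as the trace form *)

Lemma dot_pt lam x y : lam != 0 -> dot (pt lam^-1 x) (pt lam y) = tr (x * y).
Proof.
by move=> lam0; rewrite /dot /tr /c0 /c1 /c2 /= !rmorphM; field.
Qed.

Lemma wedge_neq0 lam x y : x != 0 -> y != 0 ->
  normalize (pt lam x) != normalize (pt lam y) -> wedge x y != 0.
Proof.
move=> x0 y0; apply: contraNneq => /(wedge_eq0 y0)[k sk xE].
rewrite xE pt_fixed_scale // normalize_scale //.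
by apply: contraNneq x0 => k0; rewrite xE k0 mul0r.
Qed.

(** The first coordinate identifies the scalar as [r = y / x], and the second then forces
    [s r = r]. *)
Lemma normalize_pt_fiber lam x : x != 0 ->
  [set y in nonzeroF F | normalize (pt lam y) == normalize (pt lam x)]
    = [set k * x | k in [set k | s k == k] :\ 0].
Proof.
move=> x0; apply/setP => y; rewrite !inE; apply/andP/imsetP.
  case=> y0 /normalize_eqP[r r0 e]; exists r; last by case: e.
  rewrite !inE r0; case: e => yE + _; rewrite yE rmorphM => e.
  by apply/eqP/(mulIf _ e); rewrite fmorph_eq0.
case=> k; rewrite !inE => /andP[k0 /eqP sk] ->.
by rewrite mulf_neq0 // pt_fixed_scale ?normalize_scale.
Qed.

(** The equation [tr (y * x) = 0] has [q ^ 2 - 1] nonzero solutions, and each point of the line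
    comes from [q - 1] of them. *)
Lemma card_line_pi_lam lam y : lam != 0 -> y != 0 ->
  #|[set P in pi_lam q lam | incident P (normalize (pt lam^-1 y))]| = q.+1.
Proof.
move=> lam0 y0.
pose S := [set x | tr (y * x) == 0] :\ 0.
have -> : [set P in pi_lam q lam | incident P (normalize (pt lam^-1 y))]
     = (fun x => normalize (pt lam x)) @: S.
  apply/setP => P; rewrite pi_lamE inE; apply/andP/imsetP.
    case=> /imsetP[x]; rewrite inE => x0 ->.
    rewrite incident_normalizer incident_normalizel /incident dot_pt // => e.
    by exists x => //; rewrite !inE x0.
  case=> x; rewrite !inE => /andP[x0 e] ->; split.
    by apply/imsetP; exists x; rewrite ?inE.
  by rewrite incident_normalizer incident_normalizel /incident dot_pt.
have cS : #|S| = (q ^ 2 - 1)%N.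
  have <- : #|[set x | tr x == 0] :\ 0| = (q ^ 2 - 1)%N.
    have := cardsD1 0 [set x | tr x == 0]; rewrite card_tr0.
    by rewrite inE /tr !rmorph0 !addr0 eqxx add1n => ->; rewrite subn1.
  rewrite -(card_imset _ (mulfI y0)); congr #|pred_of_set _|.
  apply/setP => z; rewrite !inE; apply/imsetP/andP.
    case=> x; rewrite !inE => /andP[x0 e] ->; by rewrite mulf_neq0.
  case=> z0 e; exists (y^-1 * z); last by rewrite mulVKf.
  by rewrite !inE mulf_neq0 ?invr_eq0 //= mulVKf.
have := @card_const_fibers _ _ (fun x => normalize (pt lam x)) S q.-1.
rewrite cS => H; apply/eqP; rewrite -(@eqn_pmul2r q.-1); last by case: q q_gt1 => [|[]].
rewrite -H; first by case: q q_gt1 => [|n] // _; apply/eqP; rewrite /=; lia.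
move=> x; rewrite inE => /andP[]; rewrite !inE => x0 trx.
have -> : q.-1 = #|[set k | s k == k] :\ 0|.
  have := cardsD1 0 [set k | s k == k]; rewrite card_fixed.
  by rewrite inE rmorph0 eqxx add1n => ->.
transitivity #|[set k * x | k in [set k | s k == k] :\ 0]|; last first.
  by rewrite card_imset //; apply: mulIf.
rewrite -(normalize_pt_fiber lam x0).
congr #|pred_of_set _|; apply/setP => z; rewrite !inE.
have [z0|z0] := eqVneq z 0; first by [].
have [|] := eqVneq (normalize (pt lam z)) (normalize (pt lam x)); rewrite ?andbF //=.
(* Incidence is invariant under scaling, so the whole fiber over a point of the line lies in [S]. *)
move/eqP/normalize_eqP=> [r r0 e]; rewrite andbT.
by move: trx; rewrite -!(dot_pt _ _ lam0) e dot_scaler => /eqP ->; rewrite mulr0 eqxx.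
Qed.

Lemma secant_pi_lam lam l : lam != 0 -> is_pv l ->
  (1 < #|[set P in pi_lam q lam | incident P l]|)%N ->
  exists2 y, y != 0 & l = normalize (pt lam^-1 y).
Proof.
move=> lam0 lpv /card_gt1P[P1 [P2 []]].
rewrite !inE pi_lamE => /andP[/imsetP[x x0 ->] i1] /andP[/imsetP[y y0 ->] i2].
move: x0 y0 i1 i2; rewrite !inE !incident_normalizel => x0 y0 /eqP i1 /eqP i2.
move=> /(wedge_neq0 x0 y0) w0.
(* Moving [lam] from the points to the line reduces the claim to joins of points [pt 1 x]. *)
pose m := mkv (c0 l) (c1 l) (lam * c2 l).
have md z : dot m (pt 1 z) = dot l (pt lam z).
  by rewrite /dot /m /pt /c0 /c1 /c2 /=; ring.
have [|||r [z [z0 mE]]] := @proportional_pt1 m x y; rewrite ?md //.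
have lE : l = scalev r (pt lam^-1 z).
  case: mE => e0 e1 e2; apply: vec_ext; rewrite ?e0 ?e1 //.
  by apply: (mulfI lam0); rewrite e2 /c2 /=; field.
have r0 : r != 0.
  case/andP: lpv => + _; apply: contraNneq => r0.
  by rewrite lE r0 vec_eq0 /c0 /c1 /c2 /= !mul0r eqxx.
by exists z => //; rewrite -(is_pvP lpv) lE normalize_scale.
Qed.

Lemma lines_of_pi_lam lam : lam != 0 ->
  lines_of q (pi_lam q lam) = pi_lam q lam^-1.
Proof.
move=> lam0; apply/setP => l; rewrite inE [in RHS]pi_lamE; apply/andP/imsetP.
  case=> lpv /eqP cl; have [|y y0 ->] := secant_pi_lam lam0 lpv.
    by rewrite cl ltnS ltnW.
  by exists y; rewrite ?inE.
case=> y; rewrite inE => y0 ->; rewrite is_pv_normalize pt_neq0 //.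
by rewrite card_line_pi_lam.
Qed.

(** The parameters 1 and a non-fixed [t] give distinct points, and [x] is chosen off their join.
    Since [pt lam] is additive, adding the parameters adds the vectors, so each determinant
    involving the fourth point is, up to sign, that of the first three. *)
Lemma pi_lam_quadrangle lam : lam != 0 ->
  exists x y z, let w := x + y + z in
  [/\ [&& x != 0, y != 0, z != 0 & w != 0],
      det3 (pt lam x) (pt lam y) (pt lam z) != 0,
      det3 (pt lam x) (pt lam y) (pt lam w) != 0,
      det3 (pt lam x) (pt lam z) (pt lam w) != 0 &
      det3 (pt lam y) (pt lam z) (pt lam w) != 0].
Proof.
move=> lam0; have [t t_nf] := exists_not_fixed.
have w0 : wedge 1 t != 0 by rewrite /wedge rmorph1 !mul1r subr_eq0.
(* These coefficients expand [det3 (pt lam x) (pt lam 1) (pt lam t)] in the conjugates of [x]. *)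
have [|x hx] := @exists_qpoly2_neq0
  (lam * s (wedge 1 t)) (lam * s (s (wedge 1 t))) (lam * wedge 1 t).
  by rewrite (mulf_neq0 lam0 w0) !orbT.
have dE : det3 (pt lam x) (pt lam 1) (pt lam t) != 0.
  rewrite /det3 cross_pt; apply: contraNneq hx => <-; apply/eqP.
  by rewrite /dot /c0 /c1 /c2 /=; ring.
have d0 y z : det3 (pt lam 0) (pt lam y) (pt lam z) = 0.
  by rewrite /det3 /dot /c0 /c1 /c2 /= !rmorph0; ring.
have ptD y z : pt lam (y + z) = mkv (c0 (pt lam y) + c0 (pt lam z))
   (c1 (pt lam y) + c1 (pt lam z)) (c2 (pt lam y) + c2 (pt lam z)).
  by apply: vec_ext; rewrite /c0 /c1 /c2 /= ?rmorphD ?rmorphD ?mulrDr.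
have d_abd a b c : det3 (pt lam a) (pt lam b) (pt lam (a + b + c)) =
    det3 (pt lam a) (pt lam b) (pt lam c).
  by rewrite !ptD /det3 /dot /cross /c0 /c1 /c2 /=; ring.
have d_swap u v w : det3 u v w = - det3 u w v.
  by rewrite /det3 /dot /cross /c0 /c1 /c2 /=; ring.
have d_rot u v w : det3 u v w = det3 v w u.
  by rewrite /det3 /dot /cross /c0 /c1 /c2 /=; ring.
have eACD : det3 (pt lam x) (pt lam t) (pt lam (x + 1 + t)) != 0.
  by rewrite addrAC d_abd d_swap oppr_eq0.
have eABD : det3 (pt lam x) (pt lam 1) (pt lam (x + 1 + t)) != 0 by rewrite d_abd.
exists x, 1, t; split=> //; last first.
  by rewrite -addrA [x + _]addrC d_abd -d_rot.
rewrite oner_neq0 /=; apply/and3P; split.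
- by apply: contraNneq dE => ->; rewrite d0.
- by apply: contraNneq dE => ->; rewrite -d_rot d0.
- by apply: contraNneq eABD => ->; rewrite -d_rot d0.
Qed.

Lemma pi_lam_Fq_plane lam : lam != 0 -> is_Fq_plane q (pi_lam q lam).
Proof.
move=> lam0; apply/and4P; split.
- apply/forall_inP => P; rewrite pi_lamE => /imsetP[x]; rewrite inE => x0 ->.
  by rewrite is_pv_normalize pt_neq0.
- apply/forallP => l; apply/implyP => lpv; case: leqP => //= h.
  by have [y y0 ->] := secant_pi_lam lam0 lpv h; rewrite card_line_pi_lam.
- apply/forall_inP => l; rewrite lines_of_pi_lam // pi_lamE.
  case/imsetP=> x; rewrite inE => x0 ->; apply/forall_inP => m.
  case/imsetP=> y; rewrite inE => y0 ->; apply/implyP => /(wedge_neq0 x0 y0) w0.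
  (* The cross product of the two lines is [lam^-1] times [pt lam (s (wedge x y))]. *)
  apply/exists_inP; exists (normalize (pt lam (s (wedge x y)))).
    by rewrite pi_lamE; apply/imsetP; exists (s (wedge x y)); rewrite ?inE ?fmorph_eq0.
  rewrite !incident_normalizer !incident_normalizel /incident !dot_pt //.
  by rewrite /tr /wedge !(rmorphB, rmorphM) !s_cubed; apply/andP; split; apply/eqP; ring.
have [x [y [z [/and4P[x0 y0 z0 w0] d1 d2 d3 d4]]]] := pi_lam_quadrangle lam0.
have inB t : t != 0 -> normalize (pt lam t) \in pi_lam q lam.
  by move=> t0; rewrite pi_lamE; apply/imsetP; exists t; rewrite ?inE.
apply/exists_inP; exists (normalize (pt lam x)); first exact: inB.
apply/exists_inP; exists (normalize (pt lam y)); first exact: inB.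
apply/exists_inP; exists (normalize (pt lam z)); first exact: inB.
apply/exists_inP; exists (normalize (pt lam (x + y + z))); first exact: inB.
by rewrite !det3_normalize d1 d2 d3 d4.
Qed.

(** In characteristic 3, [lam ^+ 3 - 1] is the cube of [lam - 1]. *)
Lemma three_neq0 lam : lam ^+ 3 = 1 -> lam != 1 -> 3%:R != 0 :> F.
Proof.
move=> l3 l1; apply: contraNneq l1 => e3; rewrite -subr_eq0.
suff: (lam - 1) ^+ 3 == 0 by rewrite expf_eq0.
apply/eqP; transitivity (lam ^+ 3 - 1 - 3%:R * lam * (lam - 1)); first by ring.
by rewrite l3 e3; ring.
Qed.

(** * The action of [mu] on [pi_lam] for a nontrivial cube root of unity *)

Section CubeRoot.
Variable lam : F.
Hypotheses (slam : s lam = lam) (lam3 : lam ^+ 3 = 1) (lam1 : lam != 1).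

Lemma cube_root_neq0 : lam != 0.
Proof. by apply: contra_eq_neq lam3 => ->; rewrite expr0n eq_sym oner_neq0. Qed.

Lemma twist_pt x : twist (pt lam x) = mkv (lam * x) (s x) (s (s x)).
Proof. by rewrite /twist /pt /c0 /c1 /c2 /= rmorphM s_cubed slam. Qed.

Lemma twist_twist_pt x : twist (twist (pt lam x)) = mkv x (lam * s x) (s (s x)).
Proof. by rewrite twist_pt /twist /c0 /c1 /c2 /= rmorphM s_cubed slam. Qed.

(* The matrix of the orbit is a circulant of determinant
   [2 - 3 * lam + lam ^+ 3 = 3 * (1 - lam)], times the norm of [x]. *)
Lemma typeIII_pt x : x != 0 -> typeIII q (normalize (pt lam x)).
Proof.
move=> x0; rewrite typeIII_normalize twist_twist_pt twist_pt.
have -> : det3 (pt lam x) (mkv (lam * x) (s x) (s (s x)))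
    (mkv x (lam * s x) (s (s x)))
  = x * s x * s (s x) * (3%:R * (1 - lam) + (lam ^+ 3 - 1)).
  by rewrite /det3 /dot /cross /pt /c0 /c1 /c2 /=; ring.
rewrite lam3 subrr addr0 !mulf_neq0 ?fmorph_eq0 ?(three_neq0 lam3 lam1) //.
by rewrite subr_eq0 eq_sym.
Qed.

Lemma mu_pt x : x != 0 -> mu q (normalize (pt lam x)) = normalize (pt lam^-1 x^-1).
Proof.
move=> x0; rewrite mu_normalize muE twist_twist_pt twist_pt.
have sx0 : s x != 0 by rewrite fmorph_eq0.
have ssx0 : s (s x) != 0 by rewrite fmorph_eq0.
have lamV : lam^-1 = lam ^+ 2.
  by apply: (mulfI cube_root_neq0); rewrite divff ?cube_root_neq0 // -exprS.
(* The scalar is read off the first two coordinates of the cross product. The third is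
   [(lam ^+ 2 - 1) * x * s x], which agrees because [lam ^+ 3 = 1]. *)
apply/eqP/normalize_eqP; exists ((1 - lam) * (x * s x * s (s x))).
  by rewrite !mulf_neq0 // subr_eq0 eq_sym.
apply: vec_ext; rewrite /cross /pt /scalev /c0 /c1 /c2 /= ?fmorphV.
- by field.
- by field.
- by rewrite lamV -[s x * x]mul1r -{1}lam3; field.
Qed.

End CubeRoot.

Lemma mu_pi_lam lam : s lam = lam -> lam ^+ 3 = 1 -> lam != 1 ->
  [set mu q P | P in pi_lam q lam] = pi_lam q lam^-1.
Proof.
move=> sl l3 l1; apply/setP => P; rewrite !pi_lamE; apply/imsetP/imsetP.
  case=> Q /imsetP[x]; rewrite inE => x0 -> ->; rewrite mu_pt //.
  by exists x^-1; rewrite ?inE ?invr_eq0.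
case=> x; rewrite inE => x0 ->; exists (normalize (pt lam x^-1)).
  by apply/imsetP; exists x^-1; rewrite ?inE ?invr_eq0.
by rewrite mu_pt ?invr_eq0 // invrK.
Qed.

Lemma good_pi_lam lam : s lam = lam -> lam ^+ 3 = 1 -> lam != 1 ->
  good_plane q (pi_lam q lam).
Proof.
move=> sl l3 l1; have l0 := cube_root_neq0 l3.
have typ k : s k = k -> k ^+ 3 = 1 -> k != 1 ->
    [forall P in pi_lam q k, typeIII q P].
  move=> sk k3 k1; apply/forall_inP => P; rewrite pi_lamE => /imsetP[x].
  by rewrite inE => x0 ->; apply: typeIII_pt.
have slV : s lam^-1 = lam^-1 by rewrite fmorphV sl.
have l3V : lam^-1 ^+ 3 = 1 by rewrite exprVn l3 invr1.
have l1V : lam^-1 != 1 by rewrite invr_eq1.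
apply/and3P; split; last 2 first.
- exact: pi_lam_Fq_plane.
- by rewrite /mu_fixes lines_of_pi_lam // !typ // !mu_pi_lam // invrK !eqxx.
apply/existsP; exists (mkv 1 1 lam).
rewrite /is_pv vec_eq0 /normalize /c0 /c1 /c2 /= oner_neq0 invr1 scale1v eqxx oner_eq0.
apply/eqP/eq_imset => x; congr normalize.
by apply: vec_ext; rewrite /c0 /c1 /c2 /= ?mulr1 // mulrC.
Qed.

(** Follow the point [(1, 1, k)]: its equal first two coordinates force its parameter in [pi_lam] to
    be fixed by [s], and the third then gives [k = lam]. *)
Lemma pi_lam_inj : injective (fun lam => pi_lam q lam).
Proof.
move=> k lam e; have : normalize (pt k 1) \in pi_lam q lam.
  by rewrite -e pi_lamE; apply/imsetP; exists 1; rewrite ?inE ?oner_neq0.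
rewrite pi_lamE => /imsetP[x _ /eqP/normalize_eqP[r r0 []]].
rewrite !rmorph1 mulr1 => /esym rx.
rewrite -{1}rx => /(mulfI r0); rewrite {1}/c1 /= => /esym xs ->.
by rewrite [s x]xs xs mulrCA rx mulr1.
Qed.

Lemma good_planeE (B : {set vec F}) : good_plane q B =
  [exists lam : F, [&& lam ^+ q == lam, lam ^+ 3 == 1, lam != 1
                     & B == pi_lam q lam]].
Proof.
apply/idP/existsP => [|[lam /and4P[sl /eqP l3 l1 /eqP ->]]]; last first.
  by apply: good_pi_lam; rewrite // sE; apply/eqP.
case/and3P=> /existsP[v /andP[_ /eqP ->]] plane /and4P[_ _ /eqP muB _].
have [||lam /and3P[sl l3 l1] e] := @pi_lam_of_mu_line v => //.
  rewrite -muB -mu_normalize; apply: imset_f; rewrite orbit_STE.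
  apply/imsetP; exists 1; rewrite ?inE ?oner_neq0 //; congr normalize.
  by apply: vec_ext; rewrite /c0 /c1 /c2 /= ?rmorph1 ?rmorph1 ?mul1r.
by exists lam; rewrite sl l3 l1 e eqxx.
Qed.

End Frobenius.

(** * Cube roots of unity and the number of planes *)

Lemma primitive_cube_root (F : finFieldType) : (3 %| #|F|.-1)%N ->
  exists2 lam : F, lam ^+ 3 = 1 & lam != 1.
Proof.
case/dvdnP=> n nE; have F1 := finNzRing_gt1 F.
have n0 : (0 < n)%N by case: n nE F1 => //; case: #|F| => [|[]].
(* The polynomial has at most [n + 1] roots, fewer than the [3 * n + 1] field elements; for a
   non-root [x], the power [x ^+ n] is the desired root of unity. *)
have [x hx] : exists x : F, x ^+ n.+1 - x != 0.
  apply/existsP; pose p := 'X^(n.+1) - 'X : {poly F}.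
  have sp : size p = n.+2.
    by rewrite size_polyDl ?size_polyXn // size_polyN size_polyX !ltnS.
  have p0 : p != 0 by rewrite -size_poly_eq0 sp.
  apply: contraLR (card_roots p0) => /existsPn h0; rewrite -leqNgt sp.
  rewrite (_ : [set _ | _] = setT) ?cardsT.
    by move: nE F1; case: #|_| => //= m -> _; rewrite ltnS; lia.
  by apply/setP => x; rewrite !inE rootE !hornerE ?hornerXn; have /negPn := h0 x.
have x0 : x != 0 by apply: contraNneq hx => ->; rewrite expr0n subrr.
exists (x ^+ n); last first.
  by apply: contraNneq hx => e; rewrite exprS e mulr1 subrr.
rewrite -exprM -nE; apply: (mulfI x0); rewrite -exprS mulr1 prednK ?expf_card //.
exact: ltnW.
Qed.

Theorem theorem4p2 (F : finFieldType) (q : nat)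
  (hq : exists p k : nat, [/\ prime p, (0 < k)%N & q = (p ^ k)%N])
  (hF : #|F| = (q ^ 3)%N) :
  (gcdn 3 q.-1 = 1%N -> forall B : {set vec F}, ~~ good_plane q B)
  /\
  (gcdn 3 q.-1 = 3%N ->
     #|[set B : {set vec F} | good_plane q B]| = 2%N /\
     forall B : {set vec F},
       good_plane q B =
       [exists lam : F, [&& lam ^+ q == lam, lam ^+ 3 == 1, lam != 1
                          & B == pi_lam q lam]]).
Proof.
have [p [k [p_pr k_gt0 qE]]] := hq.
have q_gt1 : (1 < q)%N.
  by rewrite qE -(exp1n k) ltn_exp2r // prime_gt1.
have pF : p \in [pchar F].
  by apply: (@card_finPcharP _ p (k * 3)); rewrite // hF qE expnM.
have [s sE] : exists s : {rmorphism F -> F}, forall x, s x = x ^+ q.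
  by rewrite qE; apply: rmorph_expp.
have goodE := good_planeE q_gt1 sE hF.
have q1 : (0 < q)%N by exact: ltnW.
split=> [g1 B|g3].
  rewrite goodE; apply/existsPn => lam; apply/negP => /and4P[/eqP lq /eqP l3 + _].
  case/negP; have l0 := cube_root_neq0 l3.
  have lq1 : lam ^+ q.-1 = 1 by apply: (mulfI l0); rewrite -exprS prednK // lq mulr1.
  (* Bezout: the exponents 3 and [q - 1] both send [lam] to 1, hence so does their gcd. *)
  have [u v uv _] := @egcdnP 3 q.-1 isT.
  move: (congr1 (fun i => lam ^+ i) uv); rewrite /= g1 addn1 exprSr.
  by rewrite mulnC exprM l3 expr1n mulnC exprM lq1 expr1n mul1r => <-.
have d3 : (3 %| q.-1)%N by apply/gcdn_idPl.
have qF lam : lam ^+ 3 = 1 :> F -> lam ^+ q = lam.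
  move=> l3; rewrite -(prednK q1) exprSr; case/dvdnP: d3 => n ->.
  by rewrite mulnC exprM l3 expr1n mul1r.
split=> //.
have [|w w3 w1] := @primitive_cube_root F.
  rewrite hF -[_.-1]subn1 (_ : (q ^ 3 - 1 = q ^ 3 - 1 ^ 3)%N); last by rewrite exp1n.
  by rewrite subn_exp dvdn_mulr // subn1.
have w0 := cube_root_neq0 w3.
have ww : w ^+ 2 + w + 1 = 0.
  apply: (mulIf (_ : w - 1 != 0)); first by rewrite subr_eq0.
  by rewrite mul0r; transitivity (w ^+ 3 - 1); [ring | rewrite w3 subrr].
have -> : [set B : {set vec F} | good_plane q B]
    = (fun lam => pi_lam q lam) @: [set w; w ^+ 2].
  apply/setP => B; rewrite inE goodE; apply/existsP/imsetP => -[lam].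
    case/and4P=> _ /eqP l3 l1 /eqP ->; exists lam => //; rewrite !inE -subr_eq0.
    rewrite -[X in _ || X]subr_eq0 -mulf_eq0; apply/eqP.
    (* Multiplied by [lam - 1], the product [(lam - w) * (lam - w ^+ 2)] becomes [lam ^+ 3 - 1]
       modulo the relations satisfied by [w]. *)
    apply: (mulIf (_ : lam - 1 != 0)); first by rewrite subr_eq0.
    rewrite mul0r; transitivity (lam ^+ 3 - 1
      - lam * (lam - 1) * (w ^+ 2 + w + 1) + (w ^+ 3 - 1) * (lam - 1)); first by ring.
    by rewrite l3 w3 ww; ring.
  rewrite !inE => lw ->; exists lam; rewrite eqxx andbT.
  have [l3 l1] : lam ^+ 3 = 1 /\ lam != 1.
    case/orP: lw => /eqP -> //; split; first by rewrite exprAC w3 expr1n.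
    by apply: contraNneq w1 => w2; rewrite -[w]mul1r -w2 -exprSr w3 w2.
  by apply/and3P; split=> //; apply/eqP => //; apply: qF.
rewrite card_imset; last exact: (pi_lam_inj sE).
by rewrite cards2 -[X in X == _]mulr1 expr2 (inj_eq (mulfI w0)) eq_sym w1.
Qed.
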